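(* Let $(S,\mathfrak n,k)$ be a local ring and $I\subseteq J$ ideals of $S$. Set $R=S/I$. Let $\cdots\to R^q\xrightarrow{\overline C}R^p\xrightarrow{\overline B}R^n\xrightarrow{\overline A}R^m\to M\to0$ be a minimal $R$-free resolution of an $R$-module $M$, where $A,B,C,\dots$ are matrices over $S$ and $\overline A,\overline B,\overline C,\dots$ are their images over $R$. Assume that $J$ satisfies either of the following conditions. (a) $J\supseteq I_1(A)+I_1(C)$. (b) $J\supseteq I_1(A)$ and $S/J$ is Gorenstein. If $(I:_SJ)\not\subseteq\bigl(IJ:_S(J:_S\mathfrak n)I_1(A)\bigr)$, then $S/J$ is a direct summand of $\Omega^2_RM$.
   Context: All rings are commutative and noetherian, and all modules are finitely generated. For a matrix $A$ over $S$, $I_1(A)$ is the ideal of $S$ generated by the entries of $A$. $\Omega^2_RM$ is the second syzygy of $M$ in its minimal free resolution over $R$. *)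

(* Defs.v *)
From HB Require Import structures.
From mathcomp Require Import all_boot all_order all_algebra.
From mathcomp Require Import boolp classical_sets.

Set Implicit Arguments.
Unset Strict Implicit.
Unset Printing Implicit Defensive.

Import GRing.Theory.
Local Open Scope ring_scope.
Local Open Scope classical_set_scope.
Local Open Scope quotient_scope.

Section Ideals.
Variable S : comNzRingType.
Implicit Types K L n X : set S.

(* Unlike [idealr] of ring_quotient, an ideal may be the whole ring. *)
Definition is_ideal K : Prop :=
  [/\ K 0, (forall x y, K x -> K y -> K (x + y))
    & (forall a x, K x -> K (a * x))].

Definition ideal_gen X : set S :=
  [set z | exists (k : nat) (a x : 'I_k -> S),
     (forall i, X (x i)) /\ z = \sum_(i < k) a i * x i].

Definition ideal_add K L : set S := [set x + y | x in K & y in L].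

Definition ideal_mul K L : set S := ideal_gen [set x * y | x in K & y in L].

Definition colon K L : set S := [set x | forall y, L y -> K (x * y)].

Definition I1 (p q : nat) (A : 'M[S]_(p, q)) : set S :=
  ideal_gen [set x | exists i j, x = A i j].

Definition noetherian : Prop :=
  forall K, is_ideal K -> exists s : seq S, K = ideal_gen [set` s].

Definition maximal_ideal n : Prop :=
  [/\ is_ideal n, ~ n 1
    & forall K, is_ideal K -> n `<=` K -> K 1 \/ K = n].

Definition local_ring n : Prop :=
  maximal_ideal n /\ forall n', maximal_ideal n' -> n' = n.

End Ideals.

Section Modules.
Variable R : comNzRingType.

Definition direct_summand (X Y : lmodType R) : Prop :=
  exists (Z : lmodType R) (f : {linear (X * Z)%type -> Y}), bijective f.

Definition injective_module (E : lmodType R) : Prop :=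
  forall (M N : lmodType R) (i : {linear M -> N}) (g : {linear M -> E}),
    injective i -> exists h : {linear N -> E}, forall x, h (i x) = g x.

(* There is an exact sequence 0 -> M -> E 0 -> E 1 -> ... -> E d -> 0
   with all the E i injective. *)
Definition finite_injective_dimension (M : lmodType R) : Prop :=
  exists (d : nat) (E : nat -> lmodType R) (e : {linear M -> E 0%N})
         (f : forall i, {linear E i -> E i.+1}),
    [/\ (forall i, injective_module (E i)),
        injective e,
        (forall x, f 0%N x = 0 <-> exists y, x = e y),
        (forall i x, f i.+1 x = 0 <-> exists y, x = f i y)
      & (forall i, (d < i)%N -> forall x : E i, x = 0)].

(* This is the definition for noetherian local rings; for other rings, being
   Gorenstein is a condition on the localizations. *)
Definition Gorenstein_local : Prop := finite_injective_dimension R^o.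

(* [m] is the maximal ideal of R; [r i] is the rank of the i-th free module
   R^(r i) of column vectors, and [d i] is the matrix of the differential
   R^(r i.+1) -> R^(r i). *)
Definition minimal_free_resolution (m : set R) (M : lmodType R)
    (r : nat -> nat) (d : forall i, 'M[R]_(r i, r i.+1))
    (aug : {linear 'cV[R]_(r 0%N) -> M}) : Prop :=
  [/\ (forall x, exists v, aug v = x),
      (forall v, aug v = 0 <-> exists w, v = d 0%N *m w),
      (forall i (v : 'cV[R]_(r i.+1)),
         d i *m v = 0 <-> exists w, v = d i.+1 *m w)
    & (forall i j k, m (d i j k))].

End Modules.

(* The submodule D R^q of R^p, as an R-module in its own right *)
Section MatrixImage.
Variables (R : comNzRingType) (p q : nat) (D : 'M[R]_(p, q)).

Definition mximage_pred : {pred 'cV[R]_p} :=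
  fun v => `[< exists w : 'cV[R]_q, v = D *m w >].

Lemma mximage_submod_closed : submod_closed mximage_pred.
Proof.
split; first by apply/asboolP; exists 0; rewrite mulmx0.
move=> a _ _ /asboolP[u ->] /asboolP[v ->]; apply/asboolP.
by exists (a *: u + v); rewrite mulmxDr scalemxAr.
Qed.

HB.instance Definition _ :=
  GRing.isSubmodClosed.Build R 'cV[R]_p mximage_pred mximage_submod_closed.

Definition mximage : Type := {v : 'cV[R]_p | v \in mximage_pred}.

HB.instance Definition _ := SubType.on mximage.
HB.instance Definition _ := [Choice of mximage by <:].
HB.instance Definition _ := [SubChoice_isSubLmodule of mximage by <:].

End MatrixImage.

(* Omega^2 M = im (R^(r 2) -> R^(r 1)), [d] being the differentials of the
   minimal free resolution of M. *)
Definition second_syzygy (R : comNzRingType) (r : nat -> nat)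
    (d : forall i, 'M[R]_(r i, r i.+1)) : lmodType R :=
  mximage (d 1%N).

(* S/J is a nonzero Gorenstein ring; [zmodClosed] allows J = S, whereas
   [idealr] does not. *)
Definition Gorenstein_quotient (S : comNzRingType) (J : zmodClosed S) : Prop :=
  exists2 J' : idealr S, J' =i J & Gorenstein_local {ideal_quot J'}.

(* S/J as a module over R = S/I, for ideals I <= J of S; the two proofs are
   what make the scaling by S/I well defined. *)
Definition quot_mod (S : comNzRingType) (I : idealr S) (J : zmodClosed S)
  of is_ideal [set` J] & {subset I <= J} : Type := Quotient.quot J.

Section QuotientModule.
Variables (S : comNzRingType) (I : idealr S) (J : zmodClosed S).
Hypotheses (idJ : is_ideal [set` J]) (sIJ : {subset I <= J}).

Local Notation R := {ideal_quot I}.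
Local Notation Q := (quot_mod idJ sIJ).

HB.instance Definition _ := GRing.Zmodule.on Q.

Definition quot_scale (a : R) (x : Q) : Q :=
  \pi_(Quotient.quot J) (repr a * repr (x : Quotient.quot J)).

Lemma quot_modP (x : Q) : exists s : S, x = \pi_(Quotient.quot J) s.
Proof. by exists (repr (x : Quotient.quot J)); rewrite reprK. Qed.

Lemma eq_quotP (x y : S) :
  (\pi_(Quotient.quot J) x = \pi_(Quotient.quot J) y) <-> x - y \in J.
Proof. by rewrite Quotient.idealrBE; split=> [->|/eqP]. Qed.

Lemma quot_scaleE (a x : S) :
  quot_scale (\pi_R a) (\pi_(Quotient.quot J) x)
    = \pi_(Quotient.quot J) (a * x).
Proof.
have [_ JD JM] := idJ; apply/eq_quotP.
set a' := repr _; set x' := repr _.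
have Ja : a' - a \in J.
  by apply: sIJ; rewrite Quotient.idealrBE /a' reprK.
have Jx : x' - x \in J by apply/eq_quotP; rewrite /x' reprK.
have -> : a' * x' - a * x = a' * (x' - x) + x * (a' - a).
  by rewrite !mulrBr addrA [x * a']mulrC [x * a]mulrC subrK.
by apply: JD; apply: JM.
Qed.

Lemma quot_ringP (a : R) : exists s : S, a = \pi_R s.
Proof. by exists (repr a); rewrite reprK. Qed.

Lemma quot_modD (x y : S) :
  (\pi_(Quotient.quot J) x : Q) + (\pi_(Quotient.quot J) y : Q)
    = \pi_(Quotient.quot J) (x + y).
Proof. by rewrite raddfD. Qed.

Fact quot_scalerA a b v :
  quot_scale a (quot_scale b v) = quot_scale (a * b) v.
Proof.
have [s ->] := quot_modP v; have [x ->] := quot_ringP a.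
have [y ->] := quot_ringP b; rewrite -rmorphM (quot_scaleE y s).
by rewrite (quot_scaleE x (y * s)) (quot_scaleE (x * y) s) mulrA.
Qed.

Fact quot_scale1r : left_id 1 quot_scale.
Proof.
move=> v; have [s ->] := quot_modP v.
by rewrite -(rmorph1 \pi_R) (quot_scaleE 1 s) mul1r.
Qed.

Fact quot_scalerDr : right_distributive quot_scale +%R.
Proof.
move=> a u v; have [s ->] := quot_modP u; have [t ->] := quot_modP v.
have [x ->] := quot_ringP a; rewrite (quot_scaleE x s) (quot_scaleE x t).
by rewrite !quot_modD (quot_scaleE x (s + t)) mulrDr.
Qed.

Fact quot_scalerDl v : {morph quot_scale^~ v : a b / a + b}.
Proof.
move=> a b; have [s ->] := quot_modP v; have [x ->] := quot_ringP a.
have [y ->] := quot_ringP b; rewrite -rmorphD /=.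
rewrite (quot_scaleE x s) (quot_scaleE y s) (quot_scaleE (x + y) s).
by rewrite mulrDl quot_modD.
Qed.

HB.instance Definition _ := GRing.Zmodule_isLmodule.Build R Q
  quot_scalerA quot_scale1r quot_scalerDr quot_scalerDl.

End QuotientModule.

(* Main.v *)
Require Import Defs.
From HB Require Import structures.
From mathcomp Require Import all_boot all_order all_algebra.
From mathcomp Require Import boolp classical_sets.

Set Implicit Arguments.
Unset Strict Implicit.
Unset Printing Implicit Defensive.

Import GRing.Theory.
Local Open Scope ring_scope.
Local Open Scope classical_set_scope.
Local Open Scope quotient_scope.

(* Choose x in (I : J), a in (J : n) and an entry A_ij with x a A_ij not in IJ.
   As J contains A_ij, the vector x e_j is a cycle modulo I, so x e_j = B v + u
   with u in I, and the class of B v in Omega^2 M is killed by J. If a v were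
   in C S^q + J S^p, multiplying by A would give x a A_ij in IJ. So it suffices
   to find a functional phi, killing im C modulo J, with phi v = 1 modulo J.
   In case (a) some entry of v is a unit and phi is a multiple of that
   coordinate. In case (b), a is a nonzero socle element of S/J, so S/J has
   depth zero and, having finite injective dimension, it is self-injective; phi
   then extends the functional C z + r a v |-> r a. *)

(** * Retracts, and maps out of the image of a matrix *)

Section Kernel.
Variables (R : comNzRingType) (X Y : lmodType R) (f : {linear Y -> X}).

Definition kernel_pred : {pred Y} := fun y => f y == 0.

Lemma kernel_submod_closed : submod_closed kernel_pred.
Proof.
split; first by rewrite /in_mem /= /kernel_pred raddf0.
by move=> c u v /eqP fu /eqP fv; apply/eqP; rewrite linearP fu fv scaler0 addr0.
Qed.

HB.instance Definition _ :=
  GRing.isSubmodClosed.Build R Y kernel_pred kernel_submod_closed.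

Definition kernel : Type := {y : Y | y \in kernel_pred}.

HB.instance Definition _ := SubType.on kernel.
HB.instance Definition _ := [Choice of kernel by <:].
HB.instance Definition _ := [SubChoice_isSubLmodule of kernel by <:].

End Kernel.

(** The complement is the kernel of [p]: each [y] is [i (p y)] plus [y - i (p y)], and [p] kills the
    latter. *)
Lemma direct_summand_retract (R : comNzRingType) (X Y : lmodType R)
    (i : {linear X -> Y}) (p : {linear Y -> X}) :
  cancel i p -> direct_summand X Y.
Proof.
move=> pi; pose F (u : X * kernel p) : Y := i u.1 + val u.2.
have F_lin : linear F.
  move=> c [x y] [x' y']; rewrite /F /=.
  by rewrite !linearP /= scalerDr addrACA.
pose mF := GRing.isLinear.Build R (X * kernel p)%type Y _ F F_lin.
pose FL : {linear (X * kernel p)%type -> Y} := HB.pack F mF.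
exists (kernel p), FL.
have kP y : y - i (p y) \in kernel_pred p.
  by rewrite /in_mem /= /kernel_pred raddfB /= pi subrr.
exists (fun y => (p y, Sub (y - i (p y)) (kP y) : kernel p)).
  move=> [x [y yk]]; have /eqP py : p y == 0 := yk; rewrite /= /F /=.
  have pxy : p (i x + y) = x by rewrite raddfD /= pi py addr0.
  by congr pair => //; apply: val_inj; rewrite /= pxy addrC addKr.
by move=> y; rewrite /= /F /= addrC subrK.
Qed.

(** The image of [D] is [R^q] modulo the kernel of [D], so [g] descends to it. Since [w] is an
    arbitrary preimage of [y], [h] can later be computed on any convenient one. *)
Lemma mximage_factor (R : comNzRingType) (p q : nat) (D : 'M[R]_(p, q))
    (X : lmodType R) (g : {linear 'cV[R]_q -> X}) :
  (forall w, D *m w = 0 -> g w = 0) ->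
  exists h : {linear mximage D -> X},
    forall y w, val y = D *m w -> h y = g w.
Proof.
move=> g0.
have preP (y : mximage D) : exists w, val y = D *m w by apply/asboolP/(valP y).
pose pre y := projT1 (cid (preP y)).
have pre_eq y : val y = D *m pre y by rewrite /pre; case: cid.
pose h y := g (pre y).
have hE y w : val y = D *m w -> h y = g w.
  move=> yE; apply/eqP; rewrite -subr_eq0 -raddfB /=; apply/eqP/g0.
  by rewrite mulmxBr -pre_eq -yE subrr.
have h_lin : linear h.
  move=> c x y; rewrite (hE _ (c *: pre x + pre y)); first exact: linearP.
  by rewrite mulmxDr -scalemxAr -!pre_eq.
pose mh := GRing.isLinear.Build R (mximage D) X _ h h_lin.
pose hL : {linear mximage D -> X} := HB.pack h mh.
by exists hL.
Qed.

(** * Splitting [S/J] off the image of a matrix over [S/I] *)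

Section Splitting.
Variables (S : comNzRingType) (I : idealr S) (J : zmodClosed S).
Hypotheses (idJ : is_ideal [set` J]) (sIJ : {subset I <= J}).

Local Notation R := {ideal_quot I}.
Local Notation Q := (quot_mod idJ sIJ).

Lemma quot_mod_lift (Y : lmodType R) (y : Y) :
  (forall s, s \in J -> \pi_R s *: y = 0) ->
  exists h : {linear Q -> Y},
    forall s, h (\pi_(Quotient.quot J) s) = \pi_R s *: y.
Proof.
move=> Jy; pose h (x : Q) := \pi_R (repr (x : Quotient.quot J)) *: y.
have hE s : h (\pi_(Quotient.quot J) s) = \pi_R s *: y.
  apply/eqP; rewrite -subr_eq0 -scalerBl -rmorphB; apply/eqP/Jy.
  by apply/eq_quotP; rewrite reprK.
have h_lin : linear h.
  move=> c x z; have [s ->] := quot_modP x; have [t ->] := quot_modP z.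
  have [b ->] := quot_ringP c.
  have -> : \pi_R b *: (\pi_(Quotient.quot J) s : Q)
      = \pi_(Quotient.quot J) (b * s) by exact: quot_scaleE.
  rewrite quot_modD !hE.
  by rewrite rmorphD rmorphM scalerDl scalerA.
pose mh := GRing.isLinear.Build R Q Y _ h h_lin.
pose hL : {linear Q -> Y} := HB.pack h mh.
by exists hL.
Qed.

Lemma pi_mx_eq0 p q (X : 'M[S]_(p, q)) :
  map_mx \pi_R X = 0 <-> forall i j, X i j \in I.
Proof.
split=> [X0 i j | XI].
  have := congr1 (fun Z : 'M_(p, q) => Z i j) X0; rewrite !mxE => e.
  by rewrite -[X i j]subr0 Quotient.idealrBE e rmorph0.
apply/matrixP=> i j; rewrite !mxE; apply/eqP.
by rewrite -(rmorph0 \pi_R) -Quotient.idealrBE subr0.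
Qed.

Lemma pi_mx_surj p q (X : 'M[R]_(p, q)) : exists Y, X = map_mx \pi_R Y.
Proof.
exists (map_mx repr X); apply/matrixP=> i j.
by rewrite !mxE reprK.
Qed.

(** The class of [B *m v] is killed by [J], so it receives [1] under a map from [S/J]. In the other
    direction [phi] modulo [J] descends to the image of [B], as it sends the kernel of [B] modulo
    [I] into [J]. The composite multiplies by [phi *m v], which is 1 modulo [J]. *)
Lemma quot_summand_mximage p q (B : 'M[S]_(p, q))
    (v : 'cV[S]_q) (phi : 'rV[S]_q) :
  (forall s i, s \in J -> s * (B *m v) i 0 \in I) ->
  (phi *m v) 0 0 - 1 \in J ->
  (forall w : 'cV[S]_q, (forall i, (B *m w) i 0 \in I) ->
     (phi *m w) 0 0 \in J) ->
  direct_summand Q (mximage (map_mx \pi_R B)).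
Proof.
move=> JBv phiv phiB; set d := map_mx _ B.
pose g (w : 'cV[R]_q) : Q :=
  \sum_l w l 0 *: (\pi_(Quotient.quot J) (phi 0 l) : Q).
have gE (w : 'cV[S]_q) :
    g (map_mx \pi_R w) = \pi_(Quotient.quot J) ((phi *m w) 0 0).
  rewrite !mxE raddf_sum; apply: eq_bigr => l _; rewrite mxE mulrC.
  exact: quot_scaleE.
have g_lin : linear g.
  move=> c x y; rewrite /g scaler_sumr -big_split; apply: eq_bigr => l _.
  by rewrite !mxE scalerDl scalerA.
pose mg := GRing.isLinear.Build R 'cV[R]_q Q _ g g_lin.
pose gL : {linear 'cV[R]_q -> Q} := HB.pack g mg.
have [h hE] : exists h : {linear mximage d -> Q},
    forall y w, val y = d *m w -> h y = g w.
  apply: (@mximage_factor _ _ _ d Q gL) => w0 /=; have [w ->] := pi_mx_surj w0.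
  rewrite -map_mxM gE => /pi_mx_eq0 wI.
  rewrite -(raddf0 \pi_(Quotient.quot J)); apply/eq_quotP.
  by rewrite subr0; apply: phiB => i; apply: wI.
have omP : d *m map_mx \pi_R v \in mximage_pred d.
  by apply/asboolP; exists (map_mx \pi_R v).
pose om : mximage d := exist (fun y => y \in mximage_pred d) _ omP.
have [i iE] : exists i : {linear Q -> mximage d},
    forall s, i (\pi_(Quotient.quot J) s) = \pi_R s *: om.
  apply: quot_mod_lift => s Js; apply: val_inj; rewrite linearZ /= -map_mxM.
  apply/matrixP => k l; rewrite ord1 !mxE -rmorphM.
  apply/eqP; rewrite -(rmorph0 \pi_R) -Quotient.idealrBE subr0.
  by have := JBv s k Js; rewrite mxE.
apply: (direct_summand_retract (i := i) (p := h)) => x.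
have [s ->] := quot_modP x; rewrite iE linearZ /=.
rewrite (hE _ (map_mx \pi_R v)) // gE.
have -> : \pi_(Quotient.quot J) ((phi *m v) 0 0) = \pi_(Quotient.quot J) 1.
  by apply/eq_quotP.
by rewrite -[in RHS](mulr1 s); exact: quot_scaleE.
Qed.

End Splitting.

(** * Ideals in noetherian and local rings *)

Section IdealTheory.
Variable S : comNzRingType.
Implicit Types (K L X : set S).

Lemma is_ideal_sum K (k : nat) (g : 'I_k -> S) :
  is_ideal K -> (forall i, K (g i)) -> K (\sum_i g i).
Proof. by move=> [K0 KD _] Kg; apply: (big_ind K). Qed.

Lemma is_idealB K x y : is_ideal K -> K x -> K y -> K (x - y).
Proof.
by move=> [_ KD KM] Kx Ky; apply: KD => //; rewrite -mulN1r; apply: KM.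
Qed.

Lemma ideal_gen_ideal X : is_ideal (ideal_gen X).
Proof.
split.
- by exists 0%N, (fun=> 0), (fun=> 0); split=> [[]|] //; rewrite big_ord0.
- move=> _ _ [k [a [x [Xx ->]]]] [l [b [y [Xy ->]]]].
  pose glue (f : 'I_k -> S) (g : 'I_l -> S) i :=
    match split i with inl j => f j | inr j => g j end.
  exists (k + l)%N, (glue a b), (glue x y); split.
    by move=> i; rewrite /glue; case: split.
  rewrite big_split_ord; congr (_ + _); apply: eq_bigr => i _; rewrite /glue.
    by rewrite (unsplitK (inl i)).
  by rewrite (unsplitK (inr i)).
- move=> c _ [k [a [x [Xx ->]]]]; exists k, (fun i => c * a i), x; split=> //.
  by rewrite mulr_sumr; apply: eq_bigr => i _; rewrite mulrA.
Qed.

Lemma sub_ideal_gen X : X `<=` ideal_gen X.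
Proof.
move=> x Xx; exists 1%N, (fun=> 1), (fun=> x); split=> //.
by rewrite big_ord1 mul1r.
Qed.

Lemma ideal_gen_subP X K : is_ideal K -> X `<=` K -> ideal_gen X `<=` K.
Proof.
move=> idK XK _ [k [a [x [Xx ->]]]]; apply: is_ideal_sum => // i.
by case: idK => _ _ KM; apply: KM; apply: XK.
Qed.

Lemma ideal_mulW K L x y : K x -> L y -> ideal_mul K L (x * y).
Proof. by move=> Kx Ly; apply: sub_ideal_gen; exists x => //; exists y. Qed.

Definition ideal_adjoin K y : set S := [set x + r * y | x in K & r in setT].

Lemma ideal_adjoin_ideal K y : is_ideal K -> is_ideal (ideal_adjoin K y).
Proof.
move=> [K0 KD KM]; split.
- by exists 0 => //; exists 0; rewrite ?mul0r ?addr0.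
- move=> _ _ [x Kx [r _ <-]] [z Kz [t _ <-]]; exists (x + z); first exact: KD.
  by exists (r + t) => //; rewrite mulrDl addrACA.
- move=> c _ [x Kx [r _ <-]]; exists (c * x); first exact: KM.
  by exists (c * r) => //; rewrite mulrDr mulrA.
Qed.

Lemma sub_ideal_adjoin K y : K `<=` ideal_adjoin K y.
Proof. by move=> x Kx; exists x => //; exists 0; rewrite ?mul0r ?addr0. Qed.

Lemma mem_ideal_adjoin K y : is_ideal K -> ideal_adjoin K y y.
Proof. by case=> K0 _ _; exists 0 => //; exists 1; rewrite ?mul1r ?add0r. Qed.

Definition colon_elt K y : set S := [set x | K (x * y)].

Lemma colon_elt_ideal K y : is_ideal K -> is_ideal (colon_elt K y).
Proof.
rewrite /colon_elt => -[K0 KD KM]; split=> /=.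
- by rewrite mul0r.
- by move=> x z Kx Kz; rewrite mulrDl; apply: KD.
- by move=> c x Kx; rewrite -mulrA; apply: KM.
Qed.

Hypothesis noethS : noetherian S.

(** Finitely many generators of the union already lie in one member of the chain. *)
Lemma noetherian_chain (F : set (set S)) :
  (forall K, F K -> is_ideal K) -> F !=set0 -> total_on F subset ->
  F (\bigcup_(K in F) K).
Proof.
move=> idF [K0 FK0] totF; set U := \bigcup_(_ in _) _.
have common (s : seq S) : {in s, forall x, U x} ->
    exists2 K, F K & {in s, forall x, K x}.
  elim: s => [|x s IHs] sU; first by exists K0.
  have [y sy|K FK sK] := IHs; first by apply: sU; rewrite inE sy orbT.
  have [L FL Lx] := sU x (mem_head _ _).
  have [KL|LK] := totF _ _ FK FL.
    by exists L => // y; rewrite inE => /predU1P[->|/sK /KL].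
  by exists K => // y; rewrite inE => /predU1P[->|/sK]; first exact: LK.
have idU : is_ideal U.
  split.
  - by exists K0 => //; case: (idF _ FK0).
  - move=> x y Ux Uy; have [z|K FK Kxy] := common [:: x; y].
      by rewrite !inE => /orP[] /eqP->.
    exists K => //; have [_ KD _] := idF _ FK.
    by apply: KD; apply: Kxy; rewrite !inE eqxx ?orbT.
  - move=> c x [K FK Kx]; exists K => //; have [_ _ KM] := idF _ FK.
    exact: KM.
have [s Us] := noethS idU.
have [x sx|K FK sK] := common s; first by rewrite Us; exact: sub_ideal_gen.
suff -> : U = K by [].
apply/seteqP; split; last by move=> x Kx; exists K.
by rewrite Us; apply: ideal_gen_subP; [apply: idF | exact: sK].
Qed.

Lemma noetherian_max (P : set (set S)) :
  (forall K, P K -> is_ideal K) -> P !=set0 ->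
  exists2 K, P K & forall L, P L -> K `<=` L -> L `<=` K.
Proof.
(* The empty set is adjoined to [P] because Zorn's lemma also asks for the union of the empty
   chain. *)
move=> idP [K0 PK0]; pose P' K := K = set0 \/ P K.
have [|K [P'K maxK]] := @Zorn_bigcup _ P'.
  move=> F FP totF; have [[K [FK PK]]|noP] := pselect (exists K, F K /\ P K).
    right; have FPtot : total_on (F `&` P) subset.
      by move=> L L' [FL _] [FL' _]; apply: totF.
    have [] := noetherian_chain _ _ FPtot.
    - by move=> L [_ /idP].
    - by exists K.
    rewrite (_ : \bigcup_(_ in F) _ = \bigcup_(L in F `&` P) L) //.
    apply/seteqP; split=> x [L]; last by move=> [FL _] Lx; exists L.
    move=> FL Lx; exists L => //; split=> //.
    by case: (FP _ FL) Lx => [->|].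
  left; apply/seteqP; split=> // x [K FK Kx].
  by case: (FP _ FK) => [K0'|PK]; [rewrite K0' in Kx | case: noP; exists K].
have maxK' L : P L -> K `<=` L -> L `<=` K.
  move=> PL KL; apply: contrapT => nLK; apply: (maxK L); last by right.
  by split.
case: P'K => [K_eq0|PK]; last by exists K.
have [K00 _ _] := idP _ PK0; have K0K : K 0.
  by apply: (maxK' K0) => //; rewrite K_eq0.
by rewrite K_eq0 in K0K.
Qed.

(** If [x] were not a unit, an ideal maximal among the proper ones containing [x] would be a maximal
    ideal, hence [n]. *)
Lemma local_unit (n : set S) (x : S) :
  local_ring n -> ~ n x -> exists y, y * x = 1.
Proof.
move=> [_ uniqn] nx; apply: contrapT => xNunit.
pose P K := [/\ is_ideal K, K x & ~ K 1].
have [K [] //||K [idK Kx K1] maxK] := @noetherian_max P.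
  exists (ideal_adjoin [set 0] x); split.
  - apply: ideal_adjoin_ideal; split=> //= [y z -> ->|c y ->].
      by rewrite addr0.
    by rewrite mulr0.
  - by exists 0 => //; exists 1; rewrite // mul1r add0r.
  - by move=> [_ -> [r _]]; rewrite add0r => rx; apply: xNunit; exists r.
suff Kn : maximal_ideal K by apply: nx; rewrite -(uniqn _ Kn).
split=> // L idL KL; have [L1|L1] := pselect (L 1); [by left | right].
apply/seteqP; split=> //; apply: maxK => //; split=> //; exact: KL.
Qed.

End IdealTheory.

Lemma noetherian_quot (S : comNzRingType) (J : idealr S) :
  noetherian S -> noetherian {ideal_quot J}.
Proof.
move=> noethS K [K0 KD KM].
pose pi : {rmorphism S -> {ideal_quot J}} := \pi_{ideal_quot J}.
have [|s Ks] := noethS [set x | K (pi x)].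
  split=> /= [|x y Kx Ky|a x Kx]; first by rewrite rmorph0.
    by rewrite rmorphD; apply: KD.
  by rewrite rmorphM; apply: KM.
exists [seq pi x | x <- s]; apply/seteqP; split.
  move=> x0; rewrite -[x0]reprK; set x := repr x0 => Kx.
  have : [set y | K (pi y)] x by [].
  rewrite Ks => -[k [a [y [sy xE]]]].
  exists k, (pi \o a), (pi \o y); split.
    by move=> i /=; apply: map_f; apply: sy.
  rewrite [in LHS]xE (rmorph_sum pi); apply: eq_bigr => i _; exact: rmorphM.
apply: ideal_gen_subP => // _ /= /mapP[x sx ->].
have : ideal_gen [set` s] x by apply: sub_ideal_gen.
by rewrite -Ks.
Qed.

(** * Baer's criterion and its consequences *)

Section PartialLinear.
Variable R : comNzRingType.

(* [G] is the graph of a linear map from a submodule of [U] to [E]. *)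
Definition partial_linear (U E : lmodType R) (G : U -> E -> Prop) : Prop :=
  [/\ G 0 0,
      (forall c x y u v, G x u -> G y v -> G (c *: x + y) (c *: u + v))
    & (forall u, G 0 u -> u = 0)].

(** The domain of such a [G] is an ideal of [R]. Encoding maps by their graphs avoids turning each
    ideal into a module. *)
Definition Baer (E : lmodType R) : Prop :=
  forall G : R^o -> E -> Prop, partial_linear G ->
    exists w, forall (x : R) u, G x u -> u = x *: w.

Lemma partial_linear_fun (U E : lmodType R) (G : U -> E -> Prop) x u v :
  partial_linear G -> G x u -> G x v -> u = v.
Proof.
move=> [_ Glin G0] Gu Gv; apply/eqP; rewrite eq_sym -subr_eq0; apply/eqP/G0.
by have := Glin (-1) _ _ _ _ Gu Gv; rewrite !scaleN1r addNr addrC.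
Qed.

Lemma partial_linear_dom (E : lmodType R) (G : R^o -> E -> Prop) :
  partial_linear G -> is_ideal [set x | exists u, G x u].
Proof.
move=> [G00 Glin _]; split=> /= [|x y [u Gu] [v Gv]|c x [u Gu]].
- by exists 0.
- by exists (1 *: u + v); have := Glin 1 _ _ _ _ Gu Gv; rewrite [1 *: x]mul1r.
- by exists (c *: u + 0); have := Glin c _ _ _ _ Gu G00; rewrite !addr0.
Qed.

(** On [K + R y] the assignment [z + r y |-> r e] is well defined by hypothesis; [w] is the value at
    1 of an extension to [R]. *)
Lemma Baer_divide (E : lmodType R) (K : set R) (y : R) (e : E) :
  Baer E -> is_ideal K -> (forall r, K (r * y) -> r *: e = 0) ->
  exists w : E, (forall x, K x -> x *: w = 0) /\ y *: w = e.
Proof.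
move=> baerE idK Ky; have [K0 KD KM] := idK.
pose G (x : R^o) u := exists z r, [/\ K z, x = z + r * y & u = r *: e].
have [|w Gw] := baerE G.
  split.
  - by exists 0, 0; rewrite mul0r scale0r addr0.
  - move=> c _ _ _ _ [z [r [Kz -> ->]]] [z' [r' [Kz' -> ->]]].
    exists (c * z + z'), (c * r + r'); split.
        by apply: KD => //; apply: KM.
      by rewrite [c *: _]mulrDr mulrDl addrACA mulrA.
    by rewrite scalerDl scalerA.
  - move=> _ [z [r [Kz /esym/eqP zr0 ->]]]; apply: Ky.
    move: zr0; rewrite addrC addr_eq0 => /eqP->; rewrite -mulN1r; exact: KM.
exists w; split=> [x Kx|].
  symmetry; apply: Gw; exists x, 0.
  by rewrite mul0r addr0 scale0r.
by symmetry; apply: Gw; exists 0, 1; rewrite mul1r add0r scale1r.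
Qed.

(** Induction on [p], one coordinate at a time, so only extension from ideals is used. *)
Lemma Baer_functional p (G : 'cV[R]_p -> R^o -> Prop) :
  Baer R^o -> partial_linear G ->
  exists phi : 'rV[R]_p, forall w u, G w u -> u = (phi *m w) 0 0.
Proof.
move=> baerR; elim: p G => [|p IHp];
  last rewrite -[p.+1]add1n; move=> G [G00 Glin Gfun].
  by exists 0 => w u; rewrite (flatmx0 w) mul0mx mxE; apply: Gfun.
have [|q Gq] := baerR (fun t u => G (col_mx (t%:M : 'M_1) 0) u).
  split=> [|c x y u v Gu Gv|u] /=.
  - by rewrite raddf0 col_mx0.
  - have := Glin c _ _ _ _ Gu Gv; rewrite scale_col_mx add_col_mx scaler0 addr0.
    by rewrite scale_scalar_mx -raddfD.
  - by rewrite raddf0 col_mx0; exact: Gfun.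
(* The number [q] represents [G] on the first axis. Subtracting [t * q] leaves a value depending
   only on the remaining coordinates [w]. *)
have [|phi Gphi] :=
    IHp (fun w u => exists t : R, G (col_mx (t%:M : 'M_1) w) (u + t * q)).
  split=> [|c x y u v [t Gt] [t' Gt']|u [t /Gq /eqP]].
  - by exists 0; rewrite raddf0 col_mx0 mul0r addr0.
  - exists (c * t + t'); have := Glin c _ _ _ _ Gt Gt'.
    rewrite scale_col_mx add_col_mx scale_scalar_mx -raddfD /=.
    by rewrite scalerDr mulrDl addrACA -mulrA.
  - by rewrite -subr_eq0 [t *: q]/(t * q) addrK => /eqP.
exists (row_mx (q%:M : 'M_1) phi) => w u.
rewrite -[w](@vsubmxK _ 1 p) [usubmx _]mx11_scalar; set t := usubmx _ _ _.
rewrite mul_row_col -scalar_mxM mxE mxE eqxx mulr1n => Gw.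
rewrite -(Gphi _ (u - t * q)); first by rewrite mulrC addrCA subrr addr0.
by exists t; rewrite subrK.
Qed.

End PartialLinear.

(** The domain of [G] is the image of the row [D] of its finitely many generators, so [G] becomes a
    genuine linear map on [mximage D], and the multiplier is its extension evaluated at 1. *)
Lemma injective_Baer (R : comNzRingType) (E : lmodType R) :
  noetherian R -> injective_module E -> Baer E.
Proof.
move=> noethR injE G linG; have [G00 Glin Gfun] := linG.
have [s domE] := noethR _ (partial_linear_dom linG).
have sG (i : 'I_(size s)) : exists u, G s`_i u.
  suff : [set x | exists u, G x u] s`_i by [].
  by rewrite domE; apply: sub_ideal_gen; apply: mem_nth.
pose e i := projT1 (cid (sG i)).
have Ge (i : 'I_(size s)) : G s`_i (e i) by rewrite /e; case: cid.
pose D : 'rV[R]_(size s) := \row_(i < size s) s`_i.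
pose g (w : 'cV[R]_(size s)) := \sum_i w i 0 *: e i.
have g_lin : linear g.
  move=> c x y; rewrite /g scaler_sumr -big_split; apply: eq_bigr => i _.
  by rewrite !mxE scalerDl scalerA.
pose mg := GRing.isLinear.Build R 'cV[R]_(size s) E _ g g_lin.
pose gL : {linear 'cV[R]_(size s) -> E} := HB.pack g mg.
have Gg w : G ((D *m w) 0 0) (g w).
  rewrite mxE /g; elim/big_ind2: _ => // [x u y v Gx Gy|i _].
    by have := Glin 1 _ _ _ _ Gx Gy; rewrite !scale1r.
  rewrite mxE mulrC; have := Glin (w i 0) _ _ _ _ (Ge i) G00.
  by rewrite !addr0.
have [w w0|h hE] := @mximage_factor _ _ _ D E gL.
  by have := Gg w; rewrite w0 mxE; apply: Gfun.
have [h' h'E] := injE _ _ (\val : {linear mximage D -> 'cV[R]_1}) h val_inj.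
exists (h' 1%:M) => x u Gxu.
have [w xE] : exists w : 'cV_(size s), x = (D *m w) 0 0.
  suff : ideal_gen [set` s]
      `<=` [set x | exists w : 'cV_(size s), x = (D *m w) 0 0].
    by move=> /(_ x); apply; rewrite -domE; exists u.
  apply: ideal_gen_subP => [|y /= ys].
    split=> /= [|_ _ [w ->] [w' ->]|c _ [w ->]].
    - by exists 0; rewrite mulmx0 mxE.
    - by exists (w + w'); rewrite mulmxDr [RHS]mxE.
    - by exists (c *: w); rewrite -scalemxAr [RHS]mxE.
  have yi : (index y s < size s)%N by rewrite index_mem.
  by exists (delta_mx (Ordinal yi) 0); rewrite -colE !mxE /= nth_index.
have DwP : D *m w \in mximage_pred D by apply/asboolP; exists w.
pose y : mximage D := exist (fun v => v \in mximage_pred D) _ DwP.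
have -> : u = g w by apply: (partial_linear_fun linG Gxu); rewrite xE.
rewrite -[g w](hE y) // -h'E -linearZ; congr (h' _).
by rewrite /= [LHS]mx11_scalar -xE scale_scalar_mx mulr1.
Qed.

(** * Depth zero and finite injective dimension imply self-injectivity *)

(* [socleP] says that R is local with maximal ideal the annihilator of [a]. *)
Section DepthZero.
Variables (R : comNzRingType) (a : R).
Hypotheses (noethR : noetherian R) (a_neq0 : a <> 0).
Hypothesis socleP : forall x, x * a <> 0 -> exists y, y * x = 1.
Implicit Types K L : set R.

Definition ann : set R := [set x | x * a = 0].

(** For an ideal [K] this says that [K] is primary to the maximal ideal [ann], or is the whole
    ring. *)
Definition nilp_mod K : Prop := forall y, ann y -> exists k, K (y ^+ k).

Lemma nilp_modS K L : K `<=` L -> nilp_mod K -> nilp_mod L.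
Proof. by move=> KL Knil y /Knil[k Ky]; exists k; apply: KL. Qed.

(** An ideal maximal among those avoiding [a] works: for [y] in [ann] the colon ideals of [K] by
    powers of [y] stabilise, and this forces a power of [y] into [K]. *)
Lemma socle_avoid : exists K, [/\ is_ideal K, nilp_mod K & ~ K a].
Proof.
have [K [//]||K [idK Ka] maxK] :=
    @noetherian_max R noethR (fun K => is_ideal K /\ ~ K a).
  exists [set 0]; split=> //; split=> //= [x y -> ->|c x ->].
    by rewrite addr0.
  by rewrite mulr0.
exists K; split=> // y ya; have [_ KD KM] := idK.
have [_ [k _ <-]||_ [k _ <-] maxk] :=
    @noetherian_max R noethR [set colon_elt K (y ^+ k) | k in setT].
- exact: colon_elt_ideal.
- by exists (colon_elt K (y ^+ 0)), 0%N.
exists k; apply: contrapT => Kyk.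
have [z Kz [r _ aE]] : ideal_adjoin K (y ^+ k) a.
  apply: contrapT => La; apply: Kyk.
  apply: (maxK (ideal_adjoin K (y ^+ k))).
  - by split=> //; apply: ideal_adjoin_ideal.
  - exact: sub_ideal_adjoin.
  - exact: mem_ideal_adjoin.
(* Multiply [a = z + r y^k] by [y], which kills [a]. By stability [r y^k] is then in [K] too, and so
   is [a]. *)
have Kr : colon_elt K (y ^+ k.+1) r.
  rewrite /colon_elt /= exprSr mulrA.
  have -> : r * y ^+ k * y = - y * z + y * a.
    by rewrite -aE mulrDr mulNr addKr mulrC.
  by rewrite [y * a]ya addr0; apply: KM.
have Krk : colon_elt K (y ^+ k) r.
  apply: maxk Kr; first by exists k.+1.
  by move=> x Kx; rewrite /colon_elt /= exprS mulrCA; apply: KM.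
by apply: Ka; rewrite -aE; apply: KD.
Qed.

(** Choose [z] outside [K] with [(K : z)] maximal. If [y z] were outside [K], then
    [(K : y^l z) = (K : z)] for every [l], so no [y^l z] would lie in [K], against the nilpotence of
    [y] modulo [K]. *)
Lemma nilp_mod_socle K :
  is_ideal K -> nilp_mod K -> ~ K 1 ->
  exists2 z, ~ K z & forall y, ann y -> K (y * z).
Proof.
move=> idK Knil K1; have [_ _ KM] := idK.
have [_ [z _ <-]||_ [z Kz <-] maxz] :=
    @noetherian_max R noethR [set colon_elt K z | z in ~` K].
- exact: colon_elt_ideal.
- by exists (colon_elt K 1), 1.
exists z => // y /Knil[k Kyk]; apply: contrapT => Kyz.
have Kykz l : ~ K (y ^+ l * z).
  elim: l => [|l IHl]; first by rewrite expr0 mul1r.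
  rewrite exprS -mulrA => Kyl.
  apply: Kyz; apply: (maxz (colon_elt K (y ^+ l * z))).
  - by exists (y ^+ l * z).
  - by move=> x Kx; rewrite /colon_elt /= mulrCA; apply: KM.
  - exact: Kyl.
by apply: (Kykz k); rewrite mulrC; apply: KM.
Qed.

Variables (d : nat) (E : nat -> lmodType R) (eps : {linear R^o -> E 0%N}).
Variable f : forall i, {linear E i -> E i.+1}.
Hypotheses (injE : forall i, injective_module (E i)) (eps_inj : injective eps).
Hypothesis exact0 : forall x, f 0%N x = 0 <-> exists y, x = eps y.
Hypothesis exactS : forall i x, f i.+1 x = 0 <-> exists y, x = f i y.
Hypothesis E_eq0 : forall i, (d < i)%N -> forall x : E i, x = 0.

(* This says that Ext^(j+1)(R/K, R) = 0. *)
Definition ext_vanish K j : Prop :=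
  forall e : E j.+1, f j.+1 e = 0 -> (forall x, K x -> x *: e = 0) ->
  exists2 e' : E j, (forall x, K x -> x *: e' = 0) & f j e' = e.

Let baerE i : Baer (E i) := injective_Baer noethR (@injE i).

Lemma ffE i x : f i.+1 (f i x) = 0. Proof. by apply/exactS; exists x. Qed.

(* With z outside K and ann a * z in K, the sequence
   0 -> R/ann a -> R/K -> R/(K + Rz) -> 0 reduces K to the larger K + Rz. *)
Lemma ext_vanish_nilp j :
  ext_vanish ann j -> forall K, is_ideal K -> nilp_mod K -> ext_vanish K j.
Proof.
move=> ext_ann K idK Knil; apply: contrapT => extK.
have [L [//]||L [idL Lnil extL] maxL] := @noetherian_max R noethR
  (fun L => [/\ is_ideal L, nilp_mod L & ~ ext_vanish L j]); first by exists K.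
apply: extL => e fe Le.
have [L1|L1] := pselect (L 1).
  exists 0 => [x _|]; first by rewrite scaler0.
  by rewrite raddf0 -[e]scale1r Le.
have [z Lz annz] := nilp_mod_socle idL Lnil L1.
have [|x xa|e0 ann_e0 fe0] := ext_ann (z *: e).
- by rewrite linearZ /= fe scaler0.
- by rewrite scalerA Le //; apply: annz.
(* If [r z] is in [L] then [r] is not a unit, so [r] lies in [ann] and kills [e0]. Correcting [e] by
   the boundary of [w] makes it killed by [z] as well as by [L]. *)
have [r Lrz|w [Lw zw]] := Baer_divide (@baerE j) idL (y := z) (e := e0).
  apply: ann_e0; apply: contrapT => /socleP[y yr]; apply: Lz.
  rewrite -[z]mul1r -yr -mulrA; case: idL => _ _; exact.
have extLz : ext_vanish (ideal_adjoin L z) j.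
  apply: contrapT => extLz; apply: Lz; apply: (maxL (ideal_adjoin L z)).
  - split=> //; first exact: ideal_adjoin_ideal.
    exact: nilp_modS (sub_ideal_adjoin _) Lnil.
  - exact: sub_ideal_adjoin.
  - exact: mem_ideal_adjoin.
have [||e1 Le1 fe1] := extLz (e - f j w).
- by rewrite raddfB /= fe ffE subr0.
- move=> _ [x Lx [r _ <-]]; rewrite scalerDl -scalerA.
  have -> : x *: (e - f j w) = 0.
    by rewrite scalerBr Le // -linearZ /= Lw // raddf0 subrr.
  by rewrite scalerBr -linearZ /= zw fe0 subrr scaler0 addr0.
exists (e1 + w) => [x Lx|]; last by rewrite raddfD /= fe1 subrK.
by rewrite scalerDr Lw // Le1 ?addr0 //; apply: sub_ideal_adjoin.
Qed.

(* Since a * R is a copy of the residue field k = R/ann a, the map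
   Ext^(j+1)(R/K, R) -> Ext^(j+1)(k, R) is onto for every ideal K avoiding a
   when Ext^(j+2) vanishes; a class it hits is a times a cocycle, and a times
   a cochain is killed by ann a. *)
Lemma ext_vanish_ann j :
  (forall K, is_ideal K -> nilp_mod K -> ext_vanish K j.+1) ->
  ext_vanish ann j.
Proof.
move=> extS e fe ann_e; have [K [idK Knil Ka]] := socle_avoid.
have [r Kra|e1 [Ke1 ae1]] := Baer_divide (@baerE j.+1) idK (y := a) (e := e).
  apply: ann_e; apply: contrapT => /socleP[y yr]; apply: Ka.
  rewrite -[a]mul1r -yr -mulrA; case: idK => _ _; exact.
(* The cochain [e1] need not be a cocycle, but its boundary is killed by [K] and, since [a e1 = e]
   is a cocycle, by [a]. The correction [e2] is itself killed by [a], so [a (e1 - e2) = e]. *)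
have [||||e2 Ke2 fe2] := extS (ideal_adjoin K a) _ _ (f j.+1 e1).
- exact: ideal_adjoin_ideal.
- exact: nilp_modS (sub_ideal_adjoin _) Knil.
- exact: ffE.
- move=> _ [x Kx [r _ <-]]; rewrite -linearZ /= scalerDl -scalerA Ke1 // ae1.
  by rewrite add0r linearZ /= fe scaler0.
have [e' e'E] : exists e', e1 - e2 = f j e'.
  by apply/exactS; rewrite raddfB /= fe2 subrr.
exists (a *: e') => [x xa|]; first by rewrite scalerA xa scale0r.
rewrite linearZ /= -e'E scalerBr ae1 Ke2 ?subr0 //.
exact: mem_ideal_adjoin.
Qed.

(** Descending induction on [j]: it starts at [d <= j], where [E j.+1] is zero, and each step passes
    through the residue field [R/ann]. *)
Lemma ext_vanish_all j K : is_ideal K -> nilp_mod K -> ext_vanish K j.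
Proof.
have [k le_dk] : exists k, (d <= j + k)%N by exists d; rewrite leq_addl.
elim: k j K le_dk => [|k IHk] j K le_dk idK Knil.
  move=> e _ _; exists 0 => [x _|]; first by rewrite scaler0.
  by rewrite raddf0; apply/esym/E_eq0; rewrite ltnS -(addn0 j).
apply: ext_vanish_nilp => //; apply: ext_vanish_ann => L idL Lnil.
by apply: IHk => //; rewrite addSnnS.
Qed.

(** This is the vanishing of [Ext^1(R/K, R)] for [K] the domain of [G]: an extension [w] with values
    in [E 0] is corrected by an element killed by [K] so as to come from [R]. *)
Lemma nilp_mod_extend (G : R^o -> R^o -> Prop) :
  partial_linear G -> nilp_mod [set x | exists u, G x u] ->
  exists q, forall x u, G x u -> u = x * q.
Proof.
move=> linG domG; have [G00 Glin Gfun] := linG.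
have idG := partial_linear_dom linG.
have [|w Gw] := @baerE 0%N (fun x e => exists2 u, G x u & e = eps u).
  split=> [|c x y _ _ [u Gu ->] [v Gv ->]|_ [u Gu ->]].
  - by exists 0; rewrite // raddf0.
  - by exists (c *: u + v); [apply: Glin | rewrite linearP].
  - by rewrite (Gfun _ Gu) raddf0.
have [||e' Ge' fe'] := ext_vanish_all idG domG (e := f 0%N w).
- exact: ffE.
- move=> x [u Gu]; rewrite -linearZ /= -(Gw _ (eps u)); last by exists u.
  by apply/exact0; exists u.
have /exact0[q qE] : f 0%N (w - e') = 0 by rewrite raddfB /= fe' subrr.
exists q => x u Gu; apply: eps_inj.
have -> : x * q = x *: (q : R^o) by [].
rewrite linearZ /= -qE scalerBr (Ge' x) ?subr0; last by exists u.
by apply: Gw; exists u.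
Qed.

(* A functional on R/K that is the identity on the socle is multiplication by
   a unit q with K q = 0; hence K = 0, and every ideal is nilp_mod. *)
Lemma self_Baer : Baer R^o.
Proof.
have [K [idK Knil Ka]] := socle_avoid; have [K0 KD KM] := idK.
pose G (x u : R^o) := exists z r, [/\ K z, x = z + r * a & u = r * a].
have [||q Gq] := @nilp_mod_extend G.
- split.
  + by exists 0, 0; rewrite mul0r addr0.
  + move=> c _ _ _ _ [z [r [Kz -> ->]]] [z' [r' [Kz' -> ->]]].
    exists (c * z + z'), (c * r + r'); split.
        by apply: KD => //; apply: KM.
      by rewrite [c *: _]mulrDr mulrDl addrACA mulrA.
    by rewrite mulrDl -mulrA.
  + move=> _ [z [r [Kz /esym/eqP zr0 ->]]].
    have Kra : K (r * a).
      move: zr0; rewrite addrC addr_eq0 => /eqP->.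
      by rewrite -mulN1r; apply: KM.
    apply: contrapT => /socleP[y yr]; apply: Ka.
    by rewrite -[a]mul1r -yr -mulrA; apply: KM.
- apply: nilp_modS Knil => x Kx.
  by exists 0, x, 0; rewrite mul0r addr0.
have [|y yq] := @socleP q.
  move=> qa; apply: a_neq0; rewrite -[RHS]qa mulrC; apply: Gq.
  by exists 0, 1; rewrite mul1r add0r.
have Kx0 x : K x -> x = 0.
  move=> Kx; rewrite -[x]mulr1 -yq [y * q]mulrC mulrA.
  by rewrite -(Gq x 0) ?mul0r //; exists x, 0; rewrite mul0r addr0.
move=> H linH; have [|w Hw] := nilp_mod_extend linH; last by exists w.
apply: nilp_modS Knil => x /Kx0 ->; exists 0; by case: linH.
Qed.

End DepthZero.

(** * Products of ideals, and exactness over [S/I] read over [S] *)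

Lemma idealr_is_ideal (S : comNzRingType) (I : idealr S) : is_ideal [set` I].
Proof.
split=> /= [|x y|c x Ix]; [exact: rpred0 | exact: rpredD | exact: idealMr].
Qed.

Lemma mulmx_ideal_mul (S : comNzRingType) (K L : set S) p q s
    (X : 'M[S]_(p, q)) (Y : 'M[S]_(q, s)) :
  (forall i j, K (X i j)) -> (forall i j, L (Y i j)) ->
  forall i j, ideal_mul K L ((X *m Y) i j).
Proof.
move=> KX LY i j; rewrite mxE; apply: is_ideal_sum => [|l].
  exact: ideal_gen_ideal.
exact: ideal_mulW.
Qed.

Lemma ideal_mulC (S : comNzRingType) (K L : set S) :
  ideal_mul K L `<=` ideal_mul L K.
Proof.
apply: ideal_gen_subP; first exact: ideal_gen_ideal.
by move=> _ [x Kx [y Ly <-]]; rewrite mulrC; apply: ideal_mulW.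
Qed.

(** The ideal [L I_1(A)] is generated by products of an element of [L] and an entry of [A], so a
    failure of inclusion is visible on one of them. *)
Lemma not_sub_colon_mul (S : comNzRingType) (K L P : set S) p q
    (A : 'M[S]_(p, q)) :
  is_ideal P -> ~ (K `<=` colon P (ideal_mul L (I1 A))) ->
  exists x a i j, [/\ K x, L a & ~ P (x * (a * A i j))].
Proof.
move=> idP; apply: contra_notP => noxa x Kx y.
suff : ideal_mul L (I1 A) `<=` colon_elt P x.
  by move=> /[apply]; rewrite mulrC.
apply: ideal_gen_subP; first exact: colon_elt_ideal.
move=> _ [a La [b Ab <-]]; rewrite mulrC.
suff : I1 A `<=` colon_elt P (a * x).
  by rewrite /colon_elt /= -mulrA; apply.
apply: ideal_gen_subP; first exact: colon_elt_ideal.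
move=> _ [i [j ->]]; apply: contrapT => nP; apply: noxa.
exists x, a, i, j; split=> // xaA; apply: nP.
by rewrite /colon_elt /= mulrC mulrAC -mulrA mulrCA mulrC -mulrA mulrCA.
Qed.

Section LiftExact.
Variables (S : comNzRingType) (I : idealr S) (p q s : nat).
Variables (A : 'M[S]_(p, q)) (B : 'M[S]_(q, s)).
Local Notation R := {ideal_quot I}.
Hypothesis exAB : forall v : 'cV[R]_q,
  map_mx \pi_R A *m v = 0 <-> exists w, v = map_mx \pi_R B *m w.

Lemma exact_lift_mul i j : (A *m B) i j \in I.
Proof.
have := pi_mx_eq0 I (A *m col j B); rewrite map_mxM => -[AB0 _].
have -> : (A *m B) i j = (A *m col j B) i 0.
  by rewrite !mxE; apply: eq_bigr => l _; rewrite !mxE.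
apply: AB0; apply/exAB; exists (map_mx \pi_R (delta_mx j 0)).
by rewrite -map_mxM -colE.
Qed.

Lemma exact_lift (w : 'cV[S]_q) : (forall i, (A *m w) i 0 \in I) ->
  exists z, forall i, (w - B *m z) i 0 \in I.
Proof.
move=> AwI; have /exAB[z0 wE] : map_mx \pi_R A *m map_mx \pi_R w = 0.
  by rewrite -map_mxM; apply/pi_mx_eq0 => i j; rewrite ord1.
have [z zE] := pi_mx_surj z0; exists z => i; apply: (pi_mx_eq0 I _).1.
by rewrite raddfB /= map_mxM wE zE subrr.
Qed.

End LiftExact.

(** * The functional in the Gorenstein case, and the splitting theorem *)

(** The extended functional satisfies [phi (a v) = a] modulo [J], so [phi v] does not kill [a]; it
    is therefore a unit modulo [J] and can be scaled to 1. *)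
Lemma Gorenstein_functional (S : comNzRingType) (n : set S) (J : zmodClosed S)
    (p q : nat) (C : 'M[S]_(p, q)) (v : 'cV[S]_p) (a : S) :
  noetherian S -> local_ring n -> Gorenstein_quotient J ->
  colon [set` J] n a -> 
  (forall z : 'cV_q, ~ forall l, (a *: v - C *m z) l 0 \in J) ->
  exists2 phi : 'rV[S]_p, (phi *m v) 0 0 - 1 \in J &
    forall z : 'cV_q, (phi *m (C *m z)) 0 0 \in J.
Proof.
move=> noethS locS [J' eqJ [d [E [eps [f [injE eps_inj ex0 exS E0]]]]]] na nCv.
pose Q := {ideal_quot J'}; pose pi : {rmorphism S -> Q} := \pi_Q.
have piP x : pi x = 0 <-> x \in J.
  rewrite -eqJ -{2}[x]subr0 Quotient.idealrBE; split=> [x0|/eqP].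
    by rewrite -[X in X == _]/(pi x) x0 rmorph0.
  by rewrite -[X in X = _]/(pi x) rmorph0.
have pi_surj (x : Q) : exists s, x = pi s.
  by exists (repr x); rewrite [RHS]reprK.
have mx_surj s t (X : 'M[Q]_(s, t)) : exists Y, X = map_mx pi Y.
  exact: pi_mx_surj.
have aJ : pi a <> 0.
  move=> /piP Ja; apply: (nCv 0) => l; rewrite mulmx0 subr0 mxE -eqJ mulrC.
  by apply: idealMr; rewrite eqJ.
have soc (x : Q) : x * pi a <> 0 -> exists y, y * x = 1.
  have [s ->] := pi_surj x; rewrite -rmorphM => sa.
  have [|t ts] := local_unit noethS locS (x := s).
    by move=> ns; apply: sa; apply/piP; rewrite mulrC; apply: na.
  by exists (pi t); rewrite -rmorphM ts rmorph1.
have baerQ := self_Baer (noetherian_quot noethS) aJ soc injE eps_inj ex0 exS E0.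
pose G (w : 'cV[Q]_p) (y : Q^o) := exists z t,
  w = map_mx pi C *m z + t *: map_mx pi (a *: v) /\ y = t * pi a.
have [|phi0 Gphi] := Baer_functional (G := G) baerQ.
  split.
  - by exists 0, 0; rewrite mulmx0 scale0r addr0 mul0r.
  - move=> c _ _ _ _ [z [t [-> ->]]] [z' [t' [-> ->]]].
    exists (c *: z + z'), (c * t + t'); split; last by rewrite mulrDl -mulrA.
    by rewrite mulmxDr -scalemxAr scalerDr scalerA addrACA -scalerDl.
  - move=> _ [z0 [t [zt ->]]]; apply: contrapT => /soc[y yt].
    (* From [C z0 + t a v = 0] and [y t = 1] follows [a v = C (- y z0)] modulo [J], which [nCv]
       excludes. *)
    have [z zE] := mx_surj _ _ (- y *: z0).
    apply: (nCv z) => l; apply/piP.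
    suff /(congr1 (fun X : 'cV_p => X l 0)) :
      map_mx pi (a *: v - C *m z) = 0 by rewrite !mxE.
    rewrite raddfB /= map_mxM -zE -scalemxAr scaleNr opprK.
    rewrite -[map_mx pi (a *: v)]scale1r -yt -scalerA -scalerDr addrC.
    by rewrite -zt scaler0.
have [phi1 phiE] := mx_surj _ _ phi0.
have av : pi a = pi ((phi1 *m v) 0 0) * pi a.
  have := Gphi (map_mx pi (a *: v)) (pi a).
  rewrite phiE -map_mxM -scalemxAr !mxE => {1}->.
    by rewrite rmorphM mulrC.
  by exists 0, 1; rewrite mulmx0 add0r scale1r mul1r.
have [|y0 y0E] := soc (pi ((phi1 *m v) 0 0)); first by rewrite -av.
have [y yE] := pi_surj y0; exists (y *: phi1) => [|z].
  apply/piP; rewrite -scalemxAl mxE rmorphB rmorphM -yE y0E rmorph1.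
  by rewrite subrr.
apply/piP; rewrite -scalemxAl mxE rmorphM.
have := Gphi (map_mx pi (C *m z)) 0.
rewrite phiE -map_mxM mxE => <-; first by rewrite mulr0.
by exists (map_mx pi z), 0; rewrite map_mxM scale0r addr0 mul0r.
Qed.

Theorem proposition3p4 (S : comNzRingType) (n : set S)
    (noethS : noetherian S) (locS : local_ring n)
    (I : idealr S) (J : zmodClosed S)
    (idJ : is_ideal [set` J]) (sIJ : {subset I <= J})
    (r : nat -> nat) (D : forall i, 'M[S]_(r i, r i.+1))
    (M : lmodType {ideal_quot I})
    (aug : {linear 'cV[{ideal_quot I}]_(r 0%N) -> M}) :
  let R := {ideal_quot I} in
  let d := fun i => map_mx \pi_R (D i) in
  let A := D 0%N in
  let C := D 2%N in
  minimal_free_resolution (\pi_R @` n) d aug ->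
  (ideal_add (I1 A) (I1 C) `<=` [set` J])
    \/ (I1 A `<=` [set` J] /\ Gorenstein_quotient J) ->
  ~ (colon [set` I] [set` J]
      `<=` colon (ideal_mul [set` I] [set` J])
             (ideal_mul (colon [set` J] n) (I1 A))) ->
  direct_summand (quot_mod idJ sIJ) (second_syzygy d).
Proof.
move=> R d A C [_ _ exR _] condJ.
pose B : 'M[S]_(r 1%N, r 2%N) := D 1%N.
pose IJ := ideal_mul [set` I] [set` J].
have idIJ : is_ideal IJ by apply: ideal_gen_ideal.
have [_ IJD IJM] := idIJ; have [_ JD JM] := idJ.
have AJ i j : A i j \in J.
  have IA : I1 A (A i j) by apply: sub_ideal_gen; exists i, j.
  case: condJ => [ACJ|[AJ _]]; last exact: AJ.
  apply: ACJ; exists (A i j) => //; exists 0; last by rewrite addr0.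
  by case: (ideal_gen_ideal [set x | exists i j, x = C i j]).
move=> /(not_sub_colon_mul idIJ)[x [a [i0 [j0 [Ix na nIJ]]]]].
have Id0 := idealr_is_ideal I; have [_ ID IM] := Id0.
(* The entries of [A] lie in [J] and [x J] lies in [I], so [x e_j0] is a cycle modulo [I]. *)
have [i|v vE] := exact_lift (exR 0%N) (w := x *: delta_mx j0 0).
  by rewrite -scalemxAr -colE !mxE; exact: (Ix _ (AJ _ _)).
set u := _ - _ in vE.
have xE : x *: delta_mx j0 0 = B *m v + u by rewrite /u addrC subrK.
have nCv (z : 'cV_(r 3)) : ~ forall l, (a *: v - C *m z) l 0 \in J.
  set t := _ - _ => tJ; apply: nIJ.
  have avE : a *: v = C *m z + t by rewrite /t addrC subrK.
  (* Apply [A] to [a x e_j0 = B (C z + t) + a u]. Each term is in [I J]: [B C], [A B] and [u] have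
     entries in [I], while [A] and [t] have entries in [J]. *)
  have -> : x * (a * A i0 j0)
      = (A *m (B *m C *m z)) i0 0 + ((A *m B) *m t) i0 0 + a * (A *m u) i0 0.
    transitivity ((A *m (a *: (x *: delta_mx j0 0) : 'cV_(r 1%N))) i0 0).
      by rewrite -!scalemxAr -colE !mxE mulrCA.
    rewrite xE scalerDr scalemxAr avE mulmxDr mulmxDr -scalemxAr mulmxDr.
    by rewrite !mulmxA !mxE.
  apply: (IJD _ _ (IJD _ _ _ _) (IJM _ _ _)).
  - apply: ideal_mulC; apply: mulmx_ideal_mul => // i j; rewrite mxE.
    apply: is_ideal_sum => // l; rewrite mulrC; apply: IM.
    exact: (exact_lift_mul (exR 1%N)).
  - apply: mulmx_ideal_mul => i j; first exact: (exact_lift_mul (exR 0%N)).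
    rewrite ord1; exact: tJ.
  - apply: ideal_mulC; apply: mulmx_ideal_mul => // i j.
    by rewrite ord1; exact: vE.
have [phi phiv phiC] : exists2 phi : 'rV[S]_(r 2%N), (phi *m v) 0 0 - 1 \in J &
    forall z : 'cV_(r 3), (phi *m (C *m z)) 0 0 \in J.
  case: condJ => [ACJ|[_ gorJ]]; last exact: Gorenstein_functional gorJ na nCv.
  have [l avl] : exists l, ~ a * v l 0 \in J.
    apply: contrapT => noav; apply: (nCv 0) => l.
    rewrite mulmx0 subr0 mxE; apply: contrapT => avl; apply: noav.
    by exists l.
  (* As [a n] lies in [J], the entry [v l 0] is outside [n]. The functional is the coordinate [l]
     divided by this unit; it sends the image of [C] into [J] because [I_1(C)] lies in [J]. *)
  have [|y yv] := local_unit noethS locS (x := v l 0).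
    by move=> /na.
  exists (y *: delta_mx 0 l) => [|z].
    by rewrite -scalemxAl -rowE !mxE yv subrr rpred0.
  rewrite -scalemxAl -rowE !mxE; apply: (JM); apply: is_ideal_sum => // j.
  rewrite mulrC; apply: JM; apply: ACJ; exists 0.
    by case: (ideal_gen_ideal [set x | exists i j, x = A i j]).
  exists (C l j); last by rewrite add0r.
  by apply: sub_ideal_gen; exists l, j.
apply: (quot_summand_mximage idJ sIJ (v := v) (phi := phi)) => //
  [s i Js|w BwI].
- have -> : B *m v = x *: delta_mx j0 0 - u by rewrite xE addrK.
  rewrite mxE [(- u) i 0]mxE mulrBr; apply: (is_idealB Id0).
    by rewrite mxE mulrA mulrC [s * x]mulrC; apply: (IM); exact: (Ix _ Js).
  by apply: IM; apply: vE.
(* A cycle [w] of [B] modulo [I] is [C z] up to entries in [I], hence in [J]. *)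
- have [z zI] := exact_lift (exR 1%N) BwI.
  rewrite -[w](subrK (C *m z)) mulmxDr mxE; apply: JD; last exact: phiC.
  rewrite mxE; apply: is_ideal_sum => // l; apply: JM; exact/sIJ/zI.
Qed.
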